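(* Let $D\subseteq\mathcal{C}$ be a target set and let $M^{opt}$ be an optimal stopping time for it. Let $l\in\{1,\dots,n-1\}$ and assume $M^{opt}$ is $(\varepsilon,\delta)$-differentially private with respect to $d_l$. Let $M'$ be a stopping algorithm whose outcome distribution is uniform, i.e. $\Pr[CM'(\sigma,\tau)=\sigma_k]=1/n$ for all $\sigma\in\mathcal{S}_n$ and all $k\in\{1,\dots,n\}$ (e.g. the blind choice). Let $p\in[0,1]$. Then the $p$-mix $M$ on $M^{opt}$ and $M'$ is \[\left(\ln\left(e^{\varepsilon}-\frac{(1-p)(e^{\varepsilon}-1)}{n}\right),\ p\cdot\delta\right)\text{-differentially private}\] with respect to $d_l$.
   Context: Let $\mathcal{C}=\{C_1,\dots,C_n\}$ be a set of $n$ candidates. A qualification ordering is a permutation $\sigma=(\sigma_1,\dots,\sigma_n)$ of $\mathcal{C}$, meaning $\sigma_1>\dots>\sigma_n$; $\mathcal{S}_n$ is the set of these. A time ordering is a permutation $\tau=(\tau_1,\dots,\tau_n)$ of $\mathcal{C}$ giving the arrival order; $\mathcal{T}_n$ is the set of these and $\tau$ is chosen uniformly at random from $\mathcal{T}_n$. A stopping time is a map $M:\mathcal{S}_n\times\mathcal{T}_n\to\{1,\dots,n\}$ such that whether $M(\sigma,\tau)=t$ depends only on the relative order (under $\sigma$) of $\tau_1,\dots,\tau_t$; randomized stopping algorithms may additionally use independent internal randomness. $CM(\sigma,\tau):=\tau_{M(\sigma,\tau)}$. Given a target set $D\subseteq\mathcal{C}$ (defined in terms of $\sigma$), an optimal stopping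 time $M^{opt}$ maximizes $\Pr[CM(\sigma,\tau)\in D]$ over all stopping times. The blind choice always stops at time $1$. For $p\in[0,1]$, the $p$-mix on algorithms $M''$ and $M'$ tosses an independent coin with heads probability $p$ and plays $M''$ on heads and $M'$ on tails. $d_l(\sigma,\rho)$ ($l\in\{1,\dots,n-1\}$) is the minimum $k$ with $\sigma=\pi_1\circ\cdots\circ\pi_k\circ\rho$, each $\pi_i$ a transposition of two elements at most $l$ positions apart in $\pi_{i+1}\circ\cdots\circ\pi_k\circ\rho$. $M$ is $(\varepsilon,\delta)$-differentially private w.r.t. $d_l$ if for all $S\subseteq\mathcal{C}$ and all $\sigma,\rho\in\mathcal{S}_n$ with $d_l(\sigma,\rho)\le1$: $\Pr[CM(\sigma,\tau)\in S]\le e^{\varepsilon}\Pr[CM(\rho,\tau)\in S]+\delta$.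
   Formalization: The formal theorem additionally assumes ε ≥ 0, the usual convention for differential privacy; for ε < 0 the claim fails, e.g. n = 2, l = 1, ε = -1, δ = 1, p = 0, with M' the blind choice and S = C. *)

(* Defs.v *)
From HB Require Import structures.
From mathcomp Require Import all_boot all_order all_algebra all_fingroup.
From mathcomp Require Import all_classical all_reals all_analysis.
From mathcomp Require Import zify.

Set Implicit Arguments.
Unset Strict Implicit.
Unset Printing Implicit Defensive.

Import Order.TTheory GRing.Theory Num.Theory.

(* Candidates are the elements of 'I_n.  A qualification ordering s and a time
   ordering t are bijections from positions to candidates, both of type 'S_n:
   s k is the (k+1)-st best candidate and t k the (k+1)-st to arrive. *)

Definition rank (n : nat) (s : 'S_n) (c : 'I_n) : 'I_n := (s^-1)%g c.

(* The first i.+1 arrivals (positions 0, .., i) are ordered alike by (s, t)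
   and (s', t'). *)
Definition same_relative_order (n : nat) (s t s' t' : 'S_n) (i : 'I_n) : Prop :=
  forall j k : 'I_n, (j <= i)%N -> (k <= i)%N ->
    (rank s (t j) < rank s (t k))%N = (rank s' (t' j) < rank s' (t' k))%N.

Definition is_stopping_time (n : nat) (M : 'S_n -> 'S_n -> 'I_n) : Prop :=
  forall (i : 'I_n) (s t s' t' : 'S_n),
    same_relative_order s t s' t' i -> (M s t == i) = (M s' t' == i).

Record stopping_time (n : nat) := StoppingTime {
  stop :> 'S_n -> 'S_n -> 'I_n;
  stopP : is_stopping_time stop }.

(* A randomized algorithm draws a seed from its own probability space and then
   plays the deterministic stopping time given by that seed. *)
Record stopping_algorithm (R : realType) (n : nat) := StoppingAlgorithm {
  seed_display : measure_display;
  seed : measurableType seed_display;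
  seed_law : probability seed R;
  run : seed -> stopping_time n;
  run_measurable : forall (s t : 'S_n) (i : 'I_n),
    measurable [set w : seed | run w s t = i]%classic }.

Arguments seed_law {R n} _.
Arguments run {R n} _.

Definition chosen (n : nat) (M : stopping_time n) (s t : 'S_n) : 'I_n :=
  t (M s t).

Local Open Scope ring_scope.

(* Pr[CM(s, t) \in S]: the time ordering t is uniform on 'S_n and independent
   of the seed, so the joint probability is the average over t. *)
Definition prob_chosen (R : realType) (n : nat) (A : stopping_algorithm R n)
    (s : 'S_n) (S : {set 'I_n}) : R :=
  (\sum_(t : 'S_n)
      fine (seed_law A [set w | chosen (run A w) s t \in S]%classic))
  / #|{: 'S_n}|%:R.

Lemma deterministic_measurable (n : nat) (M : stopping_time n) (s t : 'S_n)
    (i : 'I_n) :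
  measurable [set w : unit | M s t = i]%classic.
Proof. by []. Qed.

Definition deterministic (R : realType) (n : nat) (M : stopping_time n) :
    stopping_algorithm R n :=
  @StoppingAlgorithm R n _ unit (@dirac _ unit tt R) (fun=> M)
    (deterministic_measurable M).

Section mix.
Context (R : realType) (n : nat) (p : R) (A B : stopping_algorithm R n).

Definition mix_run (w : bool * (seed A * seed B)) : stopping_time n :=
  if w.1 then run A w.2.1 else run B w.2.2.

Lemma mix_measurable (s t : 'S_n) (i : 'I_n) :
  measurable [set w | mix_run w s t = i]%classic.
Proof.
rewrite (_ : [set w | _]%classic =
  ([set true] `*` ([set a | run A a s t = i] `*` setT) `|`
   [set false] `*` (setT `*` [set b | run B b s t = i]))%classic); last first.
  apply/seteqP; split => [[[] [a b]]|[[] [a b]]] /=; rewrite /mix_run /=.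
  - by left.
  - by right.
  - by case=> [[_ []]|[]].
  - by case=> [[]|[_ []]].
by apply: measurableU; apply: measurableX => //; apply: measurableX => //;
   exact: run_measurable.
Qed.

(* The seed consists of the coin and the two seeds, mutually independent. *)
Definition mix : stopping_algorithm R n :=
  @StoppingAlgorithm R n _ _
    (bernoulli_prob p \x (seed_law A \x seed_law B))%E mix_run mix_measurable.

End mix.

Arguments mix_run {R n} _ _ _.

(* D s is the target set when the qualification ordering is s. *)
Definition optimal (R : realType) (n : nat) (D : 'S_n -> {set 'I_n})
    (M : stopping_time n) : Prop :=
  forall (N : stopping_time n) (s : 'S_n),
    prob_chosen (deterministic R N) s (D s)
      <= prob_chosen (deterministic R M) s (D s).

(* a and b are distinct candidates at most l positions apart in r. *)
Definition within (n l : nat) (r : 'S_n) (a b : 'I_n) : bool :=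
  [&& a != b, (rank r a <= rank r b + l)%N & (rank r b <= rank r a + l)%N].

(* s = pi_1 o ... o pi_k o r for legal transpositions pi_i.  Products in 'S_n
   compose from left to right: pi o r is (r * pi)%g. *)
Fixpoint reachable (n l k : nat) (r s : 'S_n) : bool :=
  if k is k'.+1 then
    [exists r' : 'S_n, reachable l k' r r' &&
      [exists a, exists b, within l r' a b && (s == (r' * tperm a b)%g)]]
  else s == r.

(* The default 0 is never used when 0 < l, see swap_distP below. *)
Definition swap_dist (n l : nat) (s r : 'S_n) : nat :=
  if pselect (exists k, reachable l k r s) is left ex then ex_minn ex else 0%N.

Lemma reachable_cat (n l j k : nat) (r q s : 'S_n) :
  reachable l j r q -> reachable l k q s -> reachable l (k + j) r s.
Proof.
move=> rq; elim: k s => [s /eqP -> //|k IHk s] /=.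
case/existsP => r' /andP[/IHk qr' st].
by apply/existsP; exists r'; rewrite qr'.
Qed.

(* Swapping the candidates at positions x and y. *)
Lemma reachable_tperm (n l : nat) (l_gt0 : (0 < l)%N) (x y : 'I_n) (r : 'S_n) :
  exists k, reachable l k r (tperm x y * r)%g.
Proof.
wlog xy : x y / (x <= y)%N.
  move=> H; have [|/ltnW] := leqP x y; first exact: H.
  by rewrite tpermC; exact: H.
have [d] := ubnP (y - x)%N; elim: d x y xy r => // d IHd x y xy r.
rewrite ltnS => yxd.
have [->|nxy] := eqVneq x y.
  by exists 0%N; rewrite /= tperm1 mul1g.
have lt_xy : (x < y)%N by rewrite ltn_neqAle xy andbT.
have step (z : 'I_n) (q : 'S_n) : z = x.+1 :> nat ->
    reachable l 1 q (tperm x z * q)%g.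
  move=> zx /=; apply/existsP; exists q; rewrite eqxx /=.
  apply/existsP; exists (q x); apply/existsP; exists (q z).
  rewrite /within /rank !permK (inj_eq perm_inj) -tpermJ conjgE.
  rewrite !mulgA mulgV mul1g eqxx andbT.
  by apply/and3P; split; [rewrite -val_eqE /= zx; lia|lia|lia].
have z_lt : (x.+1 < n)%N by apply: leq_ltn_trans (ltn_ord y).
pose z := Ordinal z_lt.
have [zy|nzy] := eqVneq z y.
  by exists 1%N; apply: step; rewrite -zy.
have nxz : x != z by rewrite -val_eqE /=; lia.
have -> : tperm x y = (tperm x z * tperm z y * tperm x z)%g.
  have e : (tperm z y ^ tperm x z)%g = tperm x y.
    by rewrite tpermJ tpermR tpermD // eq_sym.
  by rewrite -{1}e conjgE tpermV mulgA.
have [|/=|k hk] := IHd z y _ (tperm x z * r)%g; rewrite /=; [lia|lia|].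
exists (1 + (k + 1))%N; rewrite -!mulgA.
apply: reachable_cat; last exact: step.
by apply: reachable_cat hk; exact: step.
Qed.

Lemma reachable_ex (n l : nat) (l_gt0 : (0 < l)%N) (r s : 'S_n) :
  exists k, reachable l k r s.
Proof.
have [ts sr _] := prod_tpermP (s * r^-1)%g.
have -> : s = (\prod_(t <- ts) tperm t.1 t.2 * r)%g by rewrite -sr mulgKV.
elim: ts {sr} => [|t ts [k hk]].
  by exists 0%N; rewrite /= big_nil mul1g.
rewrite big_cons -mulgA.
have [j hj] := reachable_tperm l_gt0 t.1 t.2 (\prod_(t <- ts) tperm t.1 t.2 * r)%g.
by exists (j + k)%N; apply: reachable_cat hk hj.
Qed.

Lemma swap_distP (n l : nat) (l_gt0 : (0 < l)%N) (s r : 'S_n) :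
  reachable l (swap_dist l s r) r s /\
  forall k, reachable l k r s -> (swap_dist l s r <= k)%N.
Proof.
rewrite /swap_dist; case: pselect => [ex|/(_ (reachable_ex l_gt0 r s))//].
by case: ex_minnP.
Qed.

Definition differentially_private (R : realType) (n l : nat) (eps delta : R)
    (A : stopping_algorithm R n) : Prop :=
  forall (S : {set 'I_n}) (s r : 'S_n), (swap_dist l s r <= 1)%N ->
    prob_chosen A s S <= expR eps * prob_chosen A r S + delta.

(* Main.v *)
(* With [c := (1 - p) (e^eps - 1) / n], [b] the probability that [Mopt] chooses
   in [S] under [r], and [m := #|S| / n], the claim reduces to
   [c (p b + (1 - p) m) <= (1 - p) (e^eps - 1) m].  The right-hand side is
   [c #|S|], so it suffices that the mix chooses in [S] with probability at most
   [#|S|]: trivial if [S] is nonempty, and [0 <= 0] otherwise. *)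
Require Import Defs.
From mathcomp Require Import all_boot all_order all_algebra all_fingroup.
From mathcomp Require Import all_classical all_reals all_analysis.
From mathcomp Require Import ring lra.
Import Order.TTheory GRing.Theory Num.Theory.
Local Open Scope ring_scope.

Section prob_chosen.
Context {R : realType} {n : nat}.
Implicit Types (A B : stopping_algorithm R n) (s t : 'S_n) (S : {set 'I_n}).

(** For fixed [t] the event is a finite union of the fibres covered by [run_measurable], one for
    each position [i] with [t i \in S]. *)
Lemma measurable_chosen A s t S :
  measurable [set w | chosen (run A w) s t \in S]%classic.
Proof.
rewrite (_ : mkset _ =
    \big[setU/set0]_(i in [pred i | t i \in S])
      [set w | run A w s t = i]%classic).
  by apply: bigsetU_measurable => i _; exact: run_measurable.
rewrite -bigcup_pred.
apply/seteqP; split=> [w Sw|w [i /= Si /= wi]]; first by exists (run A w s t).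
by rewrite /chosen wi.
Qed.

Lemma card_Sn_gt0 : 0 < #|{: 'S_n}|%:R :> R.
Proof. by rewrite ltr0n; apply/card_gt0P; exists 1%g. Qed.

Lemma prob_chosen_le1 A s S : prob_chosen A s S <= 1.
Proof.
rewrite ler_pdivrMr ?card_Sn_gt0// mul1r -sumr_const; apply: ler_sum => t _.
rewrite -lee_fin fineK ?fin_num_measure//; last exact: measurable_chosen.
exact/probability_le1/measurable_chosen.
Qed.

(** A run chooses exactly one candidate, so the events for distinct [c] are disjoint. This carries
    the uniformity of [M'] from singletons to arbitrary [S]. *)
Lemma prob_chosen_sum A s S :
  prob_chosen A s S = \sum_(c in S) prob_chosen A s [set c].
Proof.
rewrite /prob_chosen -mulr_suml exchange_big/=; congr (_ / _).
apply: eq_bigr => t _; rewrite sum_fine => [|c _]; last first.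
  by apply: fin_num_measure; exact: measurable_chosen.
rewrite -measure_bigsetU_ord_cond => [|c _|i j _ _ [w [/=]]].
- congr (fine (seed_law A _)); rewrite -(bigcup_pred (mem S)).
  apply/seteqP; split=> [w /= Sw|w [c /= Sc]]; last by rewrite inE => /eqP ->.
  by exists (chosen (run A w) s t); rewrite //= inE.
- exact: measurable_chosen.
- by rewrite !inE => /eqP <- /eqP <-.
Qed.

Lemma prob_chosen_mix (p : R) A B s S : 0 <= p <= 1 ->
  prob_chosen (mix p A B) s S =
    p * prob_chosen A s S + (1 - p) * prob_chosen B s S.
Proof.
move=> p01; rewrite /prob_chosen !mulrA -mulrDl; congr (_ / _).
rewrite !mulr_sumr -big_split/=; apply: eq_bigr => t _.
pose E (C : stopping_algorithm R n) :=
  [set w | chosen (run C w) s t \in S]%classic.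
have mE C : measurable (E C) by exact: measurable_chosen.
(* For each [t], split by the coin into two disjoint boxes; in each box the seed of the algorithm
   not played is unconstrained and contributes a factor 1. *)
rewrite (_ : mkset _ =
    ([set true] `*` (E A `*` setT) `|` [set false] `*` (setT `*` E B))%classic);
  last first.
  apply/seteqP; split=> [[[] [a b]]|[[] [a b]]] /=; rewrite /mix_run /=.
  - by left.
  - by right.
  - by case=> [[_ []]|[]].
  - by case=> [[]|[_ []]].
have lawE C X Y : measurable X -> measurable Y ->
    seed_law (mix p A B) (C `*` (X `*` Y))%classic =
      (bernoulli_prob p C * (seed_law A X * seed_law B Y))%E.
  move=> mX mY; rewrite -product_measure1E//.
  by apply: product_measure1E => //; exact: measurableX.
rewrite (measureU (seed_law (mix p A B))).
- rewrite [X in fine (X + _)%E]lawE// [X in fine (_ + X)%E]lawE//.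
  rewrite !probability_setT mule1 mul1e.
  rewrite /bernoulli_prob p01 !fsbig_set1/=.
  by rewrite fineD ?fineM ?fin_numM ?fin_num_measure.
- by apply: measurableX => //; exact: measurableX.
- by apply: measurableX => //; exact: measurableX.
- by rewrite -subset0 => -[c w] [[/= -> _] []].
Qed.

End prob_chosen.

Theorem theorem3 (R : realType) (n l : nat) (hl : (1 <= l <= n.-1)%N)
    (D : 'S_n -> {set 'I_n}) (Mopt : stopping_time n)
    (hopt : optimal R D Mopt)
    (eps delta : R) (heps : 0 <= eps)
    (hdp : differentially_private l eps delta (deterministic R Mopt))
    (M' : stopping_algorithm R n)
    (hunif : forall (s : 'S_n) (k : 'I_n), prob_chosen M' s [set s k] = n%:R^-1)
    (p : R) (hp : 0 <= p <= 1) :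
  differentially_private l
    (ln (expR eps - (1 - p) * (expR eps - 1) / n%:R)) (p * delta)
    (mix p (deterministic R Mopt) M').
Proof.
have n_gt0 : (0 < n)%N.
  by move: hl; case: n {D Mopt hopt hdp M' hunif} => [|//]; case: l.
have p0 : 0 <= p by case/andP: hp.
have q0 : 0 <= 1 - p by rewrite subr_ge0; case/andP: hp.
have e1 : 1 <= expR eps by rewrite -expR0 ler_expR.
have N0 : 0 <= n%:R^-1 :> R by rewrite invr_ge0 ler0n.
have N1 : n%:R^-1 <= 1 :> R by rewrite invf_le1 ?ltr0n// ler1n.
have unif s S : prob_chosen M' s S = n%:R^-1 *+ #|S|.
  rewrite prob_chosen_sum -sumr_const; apply: eq_bigr => c _.
  (* Every candidate has a position under [s], so [hunif] reaches all singletons. *)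
  by rewrite -[c](permKV s) hunif.
move=> S s r sr; set c := (1 - p) * _ / _.
(* Compare factor by factor, using [1 - p <= 1] and [n%:R^-1 <= 1]. The argument of [ln] is thus at
   least 1, so [expR] cancels [ln] and the multiplicative factor is exactly [expR eps - c]. *)
have c_le : c <= expR eps - 1.
  rewrite -[leRHS]mulr1 -[_ - 1 in leRHS]mul1r /c.
  rewrite !ler_pM ?mulr_ge0 ?subr_ge0//; lra.
have mixE u := @prob_chosen_mix R n p (deterministic R Mopt) M' u S hp.
rewrite lnK ?posrE; last by lra.
have := hdp S s r sr; rewrite !mixE !unif.
move: (prob_chosen_sum (deterministic R Mopt) r S).
set a := prob_chosen _ s S; set b := prob_chosen _ r S => bE ab.
set m : R := n%:R^-1 *+ #|S|.
have mN : m * n%:R = #|S|%:R.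
  by rewrite /m mulrnAl mulVf// pnatr_eq0 -lt0n.
have mix_le : p * b + (1 - p) * m <= m * n%:R.
  rewrite mN; have [S0|S1] := posnP #|S|.
    rewrite /m S0 mulr0n mulr0 addr0 bE.
    by rewrite (cards0_eq S0) big_set0 mulr0.
  apply: (@le_trans _ _ 1); last by rewrite ler1n.
  by rewrite /m -(unif r) -mixE prob_chosen_le1.
have key : c * (p * b + (1 - p) * m) <= (1 - p) * (expR eps - 1) * m.
  apply: (@le_trans _ _ (c * (m * n%:R))).
    by rewrite ler_wpM2l// /c !mulr_ge0// subr_ge0.
  suff -> : c * (m * n%:R) = (1 - p) * (expR eps - 1) * m by [].
  by rewrite /c; field; rewrite pnatr_eq0 -lt0n.
(* Scaling [ab] by [p] produces the additive term [p * delta]. The uniform part needs only factor 1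
   instead of [expR eps], and [key] says that this slack pays for subtracting [c]. *)
have := ler_wpM2l p0 ab.
lra.
Qed.
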